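(* Let $G$ be a finitely generated group. Then $G$ is Gromov-hyperbolic if and only if its strong cop number $\operatorname{sCop}(G)$ equals $1$.
   Context: Convention: $\mathbb{N}=\mathbb{Z}_{\geq 1}$. Graphs are connected, undirected, without double edges or loops, with the path metric on vertices. Game. Let $\Gamma$ be a graph. The cops and robbers game on $\Gamma$ has parameters: number of cops $n\in\mathbb{N}$, base point (treasure) $v\in\Gamma$ a vertex, cop speed $\sigma\in\mathbb{N}$, robber speed $\psi\in\mathbb{N}$, cop reach $\rho\in\mathbb{N}$, robber radius $R\in\mathbb{N}$. It is a two-player game with perfect information. First the cop player chooses $n$ vertices as starting positions of the cops, then the robber chooses a vertex as starting position. The players then alternate turns, starting with the cops. In each turn the cop player may move each cop along a path of length at most $\sigma$ to some vertex; then the robber moves along a path of length at most $\psi$ ending in a vertex. One cop move followed by one robber move is a stage. The cop player wins if the robber is captured, i.e. at some time during some stage the robber's position is at distance at most $\rho$ from some cop's position (this includes every vertex traversed by the robber during a move: the robber must traverse the path edge by edge without ever coming within distance $\rho$ of a cop), or if the cops eventually defend $v$, i.e. after some finite initial time the robber never enters the closed ball of radius $R$ around $v$. Otherwise the robber wins. The strong cop number $\operatorname{sCop}(\Gamma)\in\mathbb{N}\cup\{\infty\}$ is the infimum (with $\inf\emptyset=\infty$) of all $n\in\mathbb{N}$ such that $\forall v\in\Gamma,\ \exists\sigma\in\mathbb{N},\ \forall\psi\in\mathbb{N},\ \exists\rho\in\mathbb{N},\ \forall R\in\mathbb{N}$: the cop player has a winning strategy with $n$ cops. This number is invariant under quasi-isometry,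 so for a finitely generated group $G$ one sets $\operatorname{sCop}(G):=\operatorname{sCop}(\operatorname{Cay}(G,S))$ for any finite generating set $S$. *)

(* Defs.v *)
From HB Require Import structures.
From mathcomp Require Import all_boot all_order all_algebra.
From mathcomp Require Import boolp.

Set Implicit Arguments.
Unset Strict Implicit.
Unset Printing Implicit Defensive.

Import Order.TTheory GRing.Theory Num.Theory.

Record graph := Graph {
  vertex :> choiceType;
  adj : rel vertex;
  adj_sym : symmetric adj;
  adj_irr : irreflexive adj;
  adj_conn : forall x y, exists p, path adj x p /\ last x p = y
}.

Section Metric.
Variable Γ : graph.
Implicit Types (v w x y z : Γ) (k : nat).

(* [p] lists the vertices visited after the starting point [x], so its size is
   the number of edges of the path. *)
Definition path_le k x (p : seq Γ) : bool := path (@adj Γ) x p && (size p <= k).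

Definition joined x y k : bool :=
  `[< exists p, [/\ path (@adj Γ) x p, last x p = y & size p = k] >].

Fact ex_joined x y : exists k, joined x y k.
Proof.
by have [p [xp py]] := adj_conn x y; exists (size p); apply/asboolP; exists p.
Qed.

Definition dist x y : nat := ex_minn (ex_joined x y).

Definition gromov_product w x y : rat :=
  (((dist x w)%:R + (dist y w)%:R - (dist x y)%:R) / 2%:R)%R.

Definition hyperbolic : Prop :=
  exists2 delta : rat, (0 <= delta)%R &
  forall w x y z : Γ,
    (Num.min (gromov_product w x y) (gromov_product w y z) - delta
       <= gromov_product w x z)%R.

End Metric.

Section Game.
Variables (Γ : graph) (n : nat).

(* Stage [t] consists of the cop paths [cop_move t] followed by the robber path
   [robber_move t]; each path is given without its starting point. *)
Record play := Play {
  cop_start : 'I_n -> Γ;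
  robber_start : Γ;
  cop_move : nat -> 'I_n -> seq Γ;
  robber_move : nat -> seq Γ
}.

Fixpoint cop_pos (P : play) (t : nat) (i : 'I_n) : Γ :=
  if t is s.+1 then last (cop_pos P s i) (cop_move P s i) else cop_start P i.

Fixpoint robber_pos (P : play) (t : nat) : Γ :=
  if t is s.+1 then last (robber_pos P s) (robber_move P s)
  else robber_start P.

Definition cop_trace (P : play) (t : nat) (i : 'I_n) : seq Γ :=
  cop_pos P t i :: cop_move P t i.

Definition robber_trace (P : play) (t : nat) : seq Γ :=
  robber_pos P t :: robber_move P t.

Definition cop_legal (sigma : nat) (P : play) : Prop :=
  forall t i, path_le sigma (cop_pos P t i) (cop_move P t i).

Definition robber_legal (psi : nat) (P : play) : Prop :=
  forall t, path_le psi (robber_pos P t) (robber_move P t).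

(* The first clause concerns the cop turn of stage [t], the second one the
   robber turn, during which the cops stand at [cop_pos P t.+1]. *)
Definition captured_at (rho : nat) (P : play) (t : nat) : Prop :=
  exists i : 'I_n,
    (exists2 x, x \in cop_trace P t i & dist x (robber_pos P t) <= rho) \/
    (exists2 y, y \in robber_trace P t & dist (cop_pos P t.+1 i) y <= rho).

Definition captured (rho : nat) (P : play) : Prop :=
  exists t, captured_at rho P t.

Definition defended (v : Γ) (R : nat) (P : play) : Prop :=
  exists T, forall t, T <= t ->
  forall y, y \in robber_trace P t -> ~~ (dist v y <= R).

Definition cops_win (v : Γ) (rho R : nat) (P : play) : Prop :=
  captured rho P \/ defended v R P.

(* The cops' own past is determined by the strategy and the past of the
   robber, so a strategy only reads the latter: the robber's starting point
   and the list of the robber's moves in the previous stages. *)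
Record strategy := Strategy {
  strat_start : 'I_n -> Γ;
  strat_move : Γ -> seq (seq Γ) -> 'I_n -> seq Γ
}.

Definition follows (s : strategy) (P : play) : Prop :=
  cop_start P = strat_start s /\
  forall t, cop_move P t = strat_move s (robber_start P) (mkseq (robber_move P) t).

(* A play is never interrupted: whatever happens after a capture is irrelevant
   to [cops_win]. *)
Definition winning_strategy (v : Γ) (sigma psi rho R : nat) (s : strategy) :
    Prop :=
  forall P, follows s P -> robber_legal psi P ->
  cop_legal sigma P /\ cops_win v rho R P.

Definition strong_cop_win : Prop :=
  forall v : Γ,
  exists2 sigma, 0 < sigma &
  forall psi, 0 < psi ->
  exists2 rho, 0 < rho &
  forall R, 0 < R ->
  exists s : strategy, winning_strategy v sigma psi rho R s.

End Game.

Definition strong_cop_number_of (Γ : graph) (n : nat) : bool :=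
  (0 < n) && `[< strong_cop_win Γ n >].

(* The infimum in [{1, 2, ...} U {oo}], where [None] stands for infinity. *)
Definition sCop (Γ : graph) : option nat :=
  match pselect (exists n, strong_cop_number_of Γ n) with
  | left exn => Some (ex_minn exn)
  | right _ => None
  end.

Section Cayley.
Variables (G : groupType) (S : seq G).
Local Open Scope group_scope.

Definition generates : Prop :=
  forall H : {pred G}, group_closed H -> {subset S <= H} -> forall g, g \in H.

Definition cayley_adj : rel G :=
  fun g h => (g != h) && ((g^-1 * h \in S) || (h^-1 * g \in S)).

Fact cayley_sym : symmetric cayley_adj.
Proof. by move=> g h; rewrite /cayley_adj eq_sym orbC. Qed.

Fact cayley_irr : irreflexive cayley_adj.
Proof. by move=> g; rewrite /cayley_adj eqxx. Qed.

Let joinable g h := exists p, path cayley_adj g p /\ last g p = h.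

Let joinable_edge g h : (g^-1 * h \in S) || (h^-1 * g \in S) -> joinable g h.
Proof.
have [->|neq] := eqVneq g h; first by exists [::].
by move=> gh; exists [:: h]; rewrite /= /cayley_adj neq gh.
Qed.

Let joinable_trans g h k : joinable g h -> joinable h k -> joinable g k.
Proof.
move=> [p [gp ph]] [q [hq qk]]; exists (p ++ q).
by rewrite cat_path last_cat ph gp.
Qed.

Let joinable_sym g h : joinable g h -> joinable h g.
Proof.
move=> [p [gp <-]]; exists (rev (belast g p)); split.
  by rewrite rev_path (eq_path (e' := cayley_adj)) // => x y; apply: cayley_sym.
by case: p {gp} => //= x p; rewrite rev_cons last_rcons.
Qed.

Let joinable_mull x g h : joinable g h -> joinable (x * g) (x * h).
Proof.
move=> [p [gp <-]]; exists ([seq x * y | y <- p]); split; last by rewrite (last_map (fun y => x * y)).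
rewrite path_map (eq_path (e' := cayley_adj)) // => y z.
by rewrite /cayley_adj /= (inj_eq (mulgI x)) !invgM -!mulgA !mulKg.
Qed.

Fact cayley_conn : generates -> forall g h, joinable g h.
Proof.
move=> genS.
suff conn1 g : joinable 1 g.
  by move=> g h; apply: joinable_trans (conn1 h); apply: joinable_sym.
suff: g \in [pred x | `[< joinable 1 x >]] by move/asboolP.
apply: genS => [|s sS]; last first.
  by apply/asboolP/joinable_edge; rewrite invg1 mul1g sS.
split=> [|u v /asboolP u1 /asboolP v1]; first by apply/asboolP; exists [::].
apply/asboolP; apply: (joinable_trans u1).
by have := joinable_mull (u / v) (joinable_sym v1); rewrite mulgVK mulg1.
Qed.

Definition cayley (genS : generates) : graph :=
  Graph cayley_sym cayley_irr (cayley_conn genS).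

End Cayley.

Definition hyperbolic_group (G : groupType) : Prop :=
  exists (S : seq G) (genS : generates S), hyperbolic (cayley genS).

(* Main.v *)
From mathcomp Require Import all_boot all_order all_algebra.
From mathcomp Require Import boolp zify lra.
Require Import Defs.

Import Order.TTheory GRing.Theory Num.Theory.

(** The equivalence holds for every connected graph; groups enter only because
    hyperbolicity may be given for another generating set than the game.

    A hyperbolic graph is won by one cop.  With a geodesic drawn from the base
    point [o] to each vertex, the cop stands at distance [min t T] from [o] on
    the geodesic that ends at the robber.  While the robber is farther from [o]
    than the cop by more than one of his own moves, such a move shifts that point
    of the geodesic by an amount that depends on the hyperbolicity constant only
    ([geodesic_fellow_travel]), so a cop of bounded speed can follow; when this
    margin is lost, the robber is within reach.  The cop thus ends up guarding
    the ball of radius [T] ([strong_cop_win_of_four_point]).  The game may take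
    place in any graph that is bilipschitz to the hyperbolic one, here in the
    Cayley graph of another generating set.

    Conversely, call detour of radius [r] around [p] two arms of length at most
    [2 * r] that form a geodesic through [p], together with a path of length at
    most [M * r] that joins their ends outside the ball of radius [r] around [p].

    If no such detours exist at large radii, for [M = 20], the graph is
    hyperbolic.  A geodesic then stays close to any set with the same ends in
    which two points can be joined by a path at most three times as long as
    their distance ([no_detour_near_geodesic]): the point of the geodesic farthest
    from the set would otherwise be avoided by a detour.  If [m] is a point
    nearest to [z] on a geodesic from [x] to [y], then a geodesic from [z] to [m]
    followed by the part from [m] to [y] is such a set, so a geodesic from [z] to
    [y] passes near [m] ([no_detour_corner]).  Hence every triple of points has a
    coarse median, and this gives the four-point inequality
    ([four_point_of_medians]).

    If detours exist at arbitrarily large radii, the robber beats a single cop.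
    He waits at [p] while the cop is far from [p].  When the cop comes near, she
    cannot be close to both arms, since together they are geodesic, and he
    runs to the end of the other arm.  When she recedes he returns, if necessary
    along the bypass to the end of the arm that is free.  All these runs have
    length at most [(M + 2) * r], and a robber much faster than [M + 2] times the
    cop completes them before she has moved noticeably at scale [r]
    ([sheltered_step], [evasion]). *)

Set Implicit Arguments.
Unset Strict Implicit.
Unset Printing Implicit Defensive.

(** * Paths and geodesics *)

Section PathMetric.
Variable Γ : graph.
Implicit Types (x y z u w : Γ) (i j k n : nat) (p q : seq Γ) (Y : Γ -> Prop).

Lemma geodesic_path x y :
  exists p, [/\ path (@adj Γ) x p, last x p = y & size p = dist x y].
Proof. by rewrite /dist; case: ex_minnP => k /asboolP. Qed.

Lemma dist_last x p : path (@adj Γ) x p -> dist x (last x p) <= size p.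
Proof.
move=> xp; rewrite /dist; case: ex_minnP => k _; apply.
by apply/asboolP; exists p.
Qed.

Lemma distxx x : dist x x = 0.
Proof. by have := @dist_last x [::] isT; rewrite leqn0 => /eqP. Qed.

Lemma path_rev x p :
  path (@adj Γ) x p -> path (@adj Γ) (last x p) (rev (belast x p)).
Proof.
by rewrite rev_path (eq_path (e' := @adj Γ)) // => u w; apply: adj_sym.
Qed.

Lemma last_rev x p : last (last x p) (rev (belast x p)) = x.
Proof. by case: p => //= y p; rewrite rev_cons last_rcons. Qed.

Lemma dist_sym x y : dist x y = dist y x.
Proof.
suff le u w : dist w u <= dist u w by apply/eqP; rewrite eqn_leq !le.
have [p [up <- <-]] := geodesic_path u w.
by have := dist_last (path_rev up); rewrite last_rev size_rev size_belast.
Qed.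

Lemma dist_triangle x y z : dist x z <= dist x y + dist y z.
Proof.
have [p [xp py <-]] := geodesic_path x y.
have [q [yq <- <-]] := geodesic_path y z.
rewrite -size_cat -{1}py -last_cat dist_last //.
by rewrite cat_path xp py.
Qed.

Lemma mem_path_dist x p u :
  path (@adj Γ) x p -> u \in x :: p -> dist x u <= size p.
Proof.
rewrite inE => xp /predU1P[->|up]; first by rewrite distxx.
case/splitPr: up xp => p1 p2; rewrite -cat1s catA cat_path => /andP[xp _].
have := dist_last xp; rewrite last_cat /= => /leq_trans; apply.
by rewrite !size_cat; lia.
Qed.

Definition linked Y n x y : Prop :=
  exists p, [/\ path (@adj Γ) x p, last x p = y, size p <= n &
                forall u, u \in x :: p -> Y u].

Lemma linked_refl Y n x : Y x -> linked Y n x x.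
Proof. by move=> Yx; exists [::]; split=> // u; rewrite inE => /eqP->. Qed.

Lemma linked_trans Y n1 n2 x y z :
  linked Y n1 x y -> linked Y n2 y z -> linked Y (n1 + n2) x z.
Proof.
move=> [p [xp py sp Yp]] [q [yq qz sq Yq]]; exists (p ++ q).
rewrite cat_path last_cat py xp yq qz size_cat leq_add //; split=> // u.
rewrite -cat_cons mem_cat => /orP[/Yp //|uq].
by apply: Yq; rewrite inE uq orbT.
Qed.

Lemma linked_sym Y n x y : linked Y n x y -> linked Y n y x.
Proof.
move=> [p [xp <- sp Yp]]; exists (rev (belast x p)).
rewrite path_rev // last_rev size_rev size_belast; split=> // u.
by rewrite -mem_rev rev_cons revK -lastI => /Yp.
Qed.

Lemma sub_linked Y Y' n n' x y : (forall u, Y u -> Y' u) -> n <= n' ->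
  linked Y n x y -> linked Y' n' x y.
Proof.
move=> YY' le_n [p [xp py sp Yp]]; exists p; split=> //.
  exact: leq_trans le_n.
by move=> u /Yp/YY'.
Qed.

Lemma linked_l Y n x y : linked Y n x y -> Y x.
Proof. by case=> p [_ _ _]; apply; rewrite mem_head. Qed.

Lemma linked_r Y n x y : linked Y n x y -> Y y.
Proof. by move/linked_sym/linked_l. Qed.

Lemma dist_linked Y n x y : linked Y n x y -> dist x y <= n.
Proof. by case=> p [xp <- le_n _]; apply: leq_trans (dist_last xp) le_n. Qed.

Definition geodesic x y (g : nat -> Γ) : Prop :=
  [/\ g 0 = x, g (dist x y) = y &
      forall i j, i <= j <= dist x y -> dist (g i) (g j) = j - i].

Lemma geodesic_exists x y : exists g, geodesic x y g.
Proof.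
have [p [xp py sp]] := geodesic_path x y.
exists (fun i => nth x (x :: p) i); split=> //.
  by rewrite -sp -last_nth.
have nth_le i j : i <= j <= size p ->
    dist (nth x (x :: p) i) (nth x (x :: p) j) <= j - i.
  case/andP=> le_ij le_j; pose q := take (j - i) (drop i p).
  have lastE k : k <= size p -> last x (take k p) = nth x (x :: p) k.
    move=> le_k; rewrite (last_nth x) size_takel //.
    by rewrite -(take_cons k.+1) nth_take.
  have -> : nth x (x :: p) j = last (nth x (x :: p) i) q.
    rewrite -!lastE ?(leq_trans le_ij) // -last_cat; congr last.
    by rewrite /q -takeD subnKC.
  have -> : j - i = size q by rewrite /q size_takel // size_drop leq_sub2r.
  apply: dist_last; rewrite -lastE ?(leq_trans le_ij) //.
  move: xp; rewrite -{1}(cat_take_drop i p) cat_path => /andP[_].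
  by rewrite -{1}(cat_take_drop (j - i) (drop i p)) cat_path => /andP[].
move=> i j; rewrite -sp => /andP[le_ij le_j].
have := nth_le 0 i; have := nth_le i j; have := nth_le j (size p).
have := dist_triangle x (nth x (x :: p) i) (nth x (x :: p) j).
have := dist_triangle x (nth x (x :: p) j) y.
have nthy : nth x (x :: p) (size p) = y by rewrite -py (last_nth x).
by rewrite nthy /= -sp; lia.
Qed.

Lemma dist_geodesic x y g i j : geodesic x y g ->
  i <= dist x y -> j <= dist x y -> dist (g i) (g j) = (i - j) + (j - i).
Proof.
move=> [_ _ gd] le_i le_j; have [le_ij|/ltnW le_ji] := leqP i j.
  by rewrite gd ?le_ij //; lia.
by rewrite dist_sym gd ?le_ji //; lia.
Qed.

Lemma linked_geodesic x y g i j : geodesic x y g -> i <= j <= dist x y ->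
  linked (fun u => exists2 k, i <= k <= j & u = g k) (j - i) (g i) (g j).
Proof.
move=> geo; elim: j => [|j IHj] /andP[].
  by rewrite leqn0 => /eqP-> _; apply: linked_refl; exists 0.
rewrite leq_eqVlt => /predU1P[<- _|]; first by apply: linked_refl; exists i; rewrite ?leqnn.
rewrite ltnS => le_ij lt_j; rewrite subSn // -[(j - i).+1]addn1.
apply: (@linked_trans _ _ _ _ (g j)).
  apply: sub_linked (IHj _); [|by []|lia].
  by move=> u [k lek ->]; exists k => //; lia.
have [p [gp pj sp]] := geodesic_path (g j) (g j.+1); exists p.
have dj : dist (g j) (g j.+1) = 1 by rewrite (dist_geodesic geo); lia.
split=> //; first by rewrite sp dj.
move: p sp pj {gp} => [|w [|? ?]]; rewrite dj //= => _ -> u.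
by rewrite !inE => /orP[]/eqP->; [exists j|exists j.+1] => //; lia.
Qed.

Lemma linked_dist x y :
  linked (fun u => dist x u + dist u y = dist x y) (dist x y) x y.
Proof.
have [g geo] := geodesic_exists x y; have [gx gy _] := geo.
have := @linked_geodesic _ _ _ 0 (dist x y) geo.
rewrite gx gy subn0; move/(_ (leqnn _)); apply: sub_linked => // u [k k_le ->].
have := @dist_geodesic _ _ _ 0 k geo; have := @dist_geodesic _ _ _ k (dist x y) geo.
by rewrite gx gy; lia.
Qed.

End PathMetric.
(** * Hyperbolicity from the absence of detours *)

Section FourPoint.
Variable Γ : graph.
Implicit Types (x y z w m p a b : Γ) (r K D M : nat).

Definition four_point D : Prop := forall x y z w,
  dist x z + dist y w <= maxn (dist x y + dist z w) (dist y z + dist x w) + D.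

Lemma four_pointP : (exists D, four_point D) <-> hyperbolic Γ.
Proof.
split=> [[D fp]|[delta d_ge0 hyp]].
  exists (D%:R)%R => [|w x y z]; first exact: ler0n.
  have D_ge0 : (0 <= D%:R :> rat)%R by exact: ler0n.
  have := fp x y z w; rewrite -(ler_nat rat) !natrD natr_max !natrD.
  case: (leP (gromov_product w x y)); rewrite /gromov_product;
    case: (leP ((dist x y)%:R + _ : rat)%R); lra.
have d2_ge0 : (0 <= 2%:R * delta)%R by lra.
exists (Num.bound (2%:R * delta)%R) => x y z w.
have := archi_boundP d2_ge0; set D := Num.bound _ => lt_D.
have := hyp w x y z; rewrite -(ler_nat rat) !natrD natr_max !natrD.
case: (leP (gromov_product w x y)); rewrite /gromov_product;
  case: (leP ((dist x y)%:R + _ : rat)%R); lra.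
Qed.

(** Let [i] and [j] be the positions on a geodesic from [x] to [z] of the coarse
    medians for [y] and for [w].  If [i <= j], going from [x] to [w] and from [y]
    to [z] through the medians covers the whole geodesic and also the walk from
    [y] to [w] through both medians, so that [dist x z + dist y w] is at most
    [dist x w + dist y z] up to [K + K]; if [j <= i], [x] and [z] exchange roles. *)
Lemma four_point_of_medians K :
  (forall x y z g, geodesic x y g -> exists2 i, i <= dist x y &
     dist z (g i) + dist (g i) x <= dist z x + K /\
     dist z (g i) + dist (g i) y <= dist z y + K) ->
  four_point (K + K).
Proof.
move=> medians x y z w; have [g geo] := geodesic_exists x z.
have [i le_i [yx yz]] := medians _ _ y _ geo.
have [j le_j [wx wz]] := medians _ _ w _ geo.
have [gx gz _] := geo.
have dg k l := @dist_geodesic Γ x z g k l geo.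
have dgx k : k <= dist x z -> dist (g k) x = k.
  by move=> le_k; rewrite -gx dg //; lia.
have dgz k : k <= dist x z -> dist (g k) z = dist x z - k.
  by move=> le_k; rewrite -{1}gz dg //; lia.
have := dist_triangle y (g i) w; have := dist_triangle (g i) (g j) w.
rewrite (dg i j) // (dist_sym (g j) w) (dist_sym z w) (dist_sym x y) (dist_sym x w).
by move: yx yz wx wz; rewrite !dgx // !dgz //; lia.
Qed.

(** The arms are only recorded through sets [A] and [B] that contain them.  The
    distance condition says that any path running along one arm to [p] and along
    the other away from [p] is geodesic. *)
Definition detour M r p a b : Prop := exists A B : Γ -> Prop,
  [/\ linked A (2 * r) p a, linked B (2 * r) p b,
      forall u w, A u -> B w -> dist u w = dist p u + dist p w &
      linked (fun u => r <= dist p u) (M * r) a b].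

Definition no_detour M r0 : Prop :=
  forall r p a b, r0 <= r -> ~ detour M r p a b.

(** The argument of the Morse lemma.  Let [g p] be a point of the
    geodesic at maximal distance [r] from [Y].  Go away from it by [2 * r] on both
    sides, or up to an end of the geodesic; step from the points reached to [Y],
    at most [r] away, outside the ball of radius [r] around [g p]; join inside
    [Y].  The points reached in [Y] are at most [6 * r] apart, so the whole bypass
    has length at most [(6 * l + 2) * r]. *)
Lemma no_detour_near_geodesic l r0 (Y : Γ -> Prop) x y g i :
  no_detour (6 * l + 2) r0 ->
  (forall u w, Y u -> Y w -> linked Y (l * dist u w) u w) ->
  Y x -> Y y -> geodesic x y g -> i <= dist x y ->
  exists2 u, Y u & dist (g i) u < r0.
Proof.
move=> nodet qcY Yx Yy geo le_i; apply: contrapT => far_i.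
have [gx gy _] := geo; have dg := @dist_geodesic Γ x y g _ _ geo.
pose far r := `[< exists2 k, k <= dist x y & forall u, Y u -> r <= dist (g k) u >].
have far_r0 : far r0.
  apply/asboolP; exists i => // u Yu; rewrite leqNgt; apply/negP=> lt_u.
  by apply: far_i; exists u.
have far_le r : far r -> r <= dist x y.
  move=> /asboolP[k le_k /(_ _ Yx)/leq_trans]; apply.
  by rewrite -{1}gx dg //; lia.
have ex_far : exists r, far r by exists r0.
case: (ex_maxnP ex_far far_le) => r /asboolP[p le_p far_p] max_r.
have le_r := max_r _ far_r0.
have near k : k <= dist x y -> exists2 u, Y u & dist (g k) u <= r.
  move=> le_k; apply: contrapT => no_u.
  suff /max_r : far r.+1 by rewrite ltnn.
  apply/asboolP; exists k => // u Yu; rewrite ltnNge; apply/negP=> le_u.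
  by apply: no_u; exists u.
(* An end of the geodesic may be closer to [g p] than [2 * r], but it lies in
   [Y], so no step is needed there. *)
have escape k : k <= dist x y -> dist (g p) (g k) = 2 * r \/ Y (g k) ->
    exists2 u, Y u & linked (fun v => r <= dist (g p) v) r (g k) u.
  move=> le_k [eq_k|Yk]; last by exists (g k) => //; apply/linked_refl/far_p.
  have [u Yu le_u] := near k le_k; exists u => //.
  apply: sub_linked (linked_dist _ _) => // v eq_v.
  by have := dist_triangle (g p) v (g k); rewrite (dist_sym v); lia.
have [le_1 le_2] : p - 2 * r <= dist x y /\ minn (p + 2 * r) (dist x y) <= dist x y.
  by lia.
have [u Yu au] : exists2 u, Y u &
    linked (fun v => r <= dist (g p) v) r (g (p - 2 * r)) u.
  apply: escape => //; have [le|lt] := leqP (2 * r) p; first by left; rewrite dg //; lia.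
  by right; have -> : p - 2 * r = 0 by [lia]; rewrite gx.
have [w Yw bw] : exists2 w, Y w &
    linked (fun v => r <= dist (g p) v) r (g (minn (p + 2 * r) (dist x y))) w.
  apply: escape => //; have [le|lt] := leqP (p + 2 * r) (dist x y).
    by left; rewrite dg //; lia.
  by right; rewrite gy.
apply: (nodet r (g p) (g (p - 2 * r)) (g (minn (p + 2 * r) (dist x y)))) => //.
exists (fun v => exists2 k, p - 2 * r <= k <= p & v = g k).
exists (fun v => exists2 k, p <= k <= minn (p + 2 * r) (dist x y) & v = g k).
split.
- by apply: linked_sym; apply: sub_linked (linked_geodesic geo _) => //; lia.
- by apply: sub_linked (linked_geodesic geo _) => //; lia.
- by move=> _ _ [k lek ->] [j lej ->]; rewrite !dg; lia.
have uw := sub_linked far_p (leqnn _) (qcY u w Yu Yw).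
apply: sub_linked (linked_trans au (linked_trans uw (linked_sym bw))) => //.
have : dist u w <= 6 * r; last first.
  move/(leq_mul (leqnn l)); rewrite mulnDl (mulnC 6 l) -mulnA; lia.
have := dist_linked au; have := dist_linked bw.
have := dist_triangle u (g (p - 2 * r)) w.
have := dist_triangle (g (p - 2 * r)) (g (minn (p + 2 * r) (dist x y))) w.
by rewrite (dist_sym u (g _)) (dg (p - 2 * r)) //; lia.
Qed.

Lemma linked_geodesic_range x y g i j : geodesic x y g ->
  i <= dist x y -> j <= dist x y ->
  linked (fun u => exists2 k, k <= dist x y & u = g k) (dist (g i) (g j))
         (g i) (g j).
Proof.
move=> geo; wlog le_ij : i j / i <= j => [wlog_ij|le_i le_j].
  move=> le_i le_j; have [/wlog_ij|/ltnW/wlog_ij] := leqP i j; first exact.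
  by move=> ji; rewrite (dist_sym (g i)); apply/linked_sym/ji.
rewrite (dist_geodesic geo) //; apply: sub_linked (linked_geodesic geo _).
- by move=> u [k lek ->]; exists k => //; lia.
- by lia.
- by lia.
Qed.

(** Since [m] is nearest to [z], a geodesic from [z] to [m] followed by [h] is
    never more than three times longer than the distance between its points, so a
    geodesic [g] from [z] to [y] stays within [r0] of it.  At the last moment when
    [g] is near the first leg it is near both legs, and a point of the first leg
    that is close to the second leg must be close to [m]. *)
Lemma no_detour_corner r0 z m y h : no_detour 20 r0 -> geodesic m y h ->
  (forall k, k <= dist m y -> dist z m <= dist z (h k)) ->
  dist z m + dist m y <= dist z y + 6 * r0.
Proof.
move=> nodet geoh nearest; have [h1 geo1] := geodesic_exists z m.
have [g geo] := geodesic_exists z y.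
have [gz gy _] := geo; have [hm hy _] := geoh; have [h1z h1m _] := geo1.
have dg := @dist_geodesic Γ z y g _ _ geo.
have dh := @dist_geodesic Γ m y h _ _ geoh.
have dh1 := @dist_geodesic Γ z m h1 _ _ geo1.
pose Y1 u := exists2 k, k <= dist z m & u = h1 k.
pose Y2 u := exists2 k, k <= dist m y & u = h k.
have cross u w : Y1 u -> Y2 w ->
    linked (fun v => Y1 v \/ Y2 v) (3 * dist u w) u w.
  move=> [i le_i ->] [j le_j ->].
  have l1 := linked_geodesic_range geo1 le_i (leqnn _).
  have l2 := linked_geodesic_range geoh (leq0n _) le_j.
  rewrite h1m in l1; rewrite hm in l2.
  have := linked_trans (sub_linked _ (leqnn _) l1) (sub_linked _ (leqnn _) l2).
  move=> /(_ (fun v => Y1 v \/ Y2 v)) cat12; apply: sub_linked (cat12 _ _) => //; first last.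
  - by right.
  - by left.
  have := dist_triangle z (h1 i) (h j); have := nearest j le_j.
  have := dist_triangle m (h1 i) (h j); have := dh1 0 i; have := dh1 i (dist z m).
  by rewrite h1z h1m (dist_sym m (h1 i)); lia.
pose Y v := Y1 v \/ Y2 v.
have near i : i <= dist z y -> exists2 u, Y u & dist (g i) u < r0.
  apply: (@no_detour_near_geodesic 3 r0 Y z y g i) => //.
  - move=> u w [Yu|Yu] [Yw|Yw]; last 1 first.
    + case: Yu Yw => [i1 le1 ->] [i2 le2 ->].
      apply: sub_linked (linked_geodesic_range geoh le1 le2); last by lia.
      by right.
    + case: Yu Yw => [i1 le1 ->] [i2 le2 ->].
      apply: sub_linked (linked_geodesic_range geo1 le1 le2); last by lia.
      by left.
    + exact: cross.
    by rewrite dist_sym; apply/linked_sym/cross.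
  - by left; exists 0.
  - by right; exists (dist m y).
pose near1 k := `[< k <= dist z y /\ exists2 u, Y1 u & dist (g k) u < r0 >].
have r0_gt0 : 0 < r0 by have [u _] := near 0 (leq0n _); lia.
have near10 : near1 0.
  apply/asboolP; split=> //; exists z; first by exists 0.
  by rewrite gz distxx.
have near1_le k : near1 k -> k <= dist z y by case/asboolP.
have ex_near1 : exists k, near1 k by exists 0.
case: (ex_maxnP ex_near1 near1_le) => k /asboolP[le_k [s Ys ks]] max_k.
have [t Yt kt] : exists2 t, Y2 t & dist (g k) t <= r0.
  have [lt_k|ge_k] := ltnP k (dist z y); last first.
    exists y; first by exists (dist m y).
    by have -> : k = dist z y by [lia]; rewrite gy distxx.
  have [t [Yt|Yt] kt] := near k.+1 lt_k.
    suff /max_k : near1 k.+1 by rewrite ltnn.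
    by apply/asboolP; split=> //; exists t.
  exists t => //; have := dist_triangle (g k) (g k.+1) t.
  by rewrite dg //; lia.
case: Ys Yt => [i le_i s_i] [j le_j t_j].
have := nearest j le_j; rewrite -t_j => le_zt.
have := dist_triangle z s t; have := dist_triangle s (g k) t.
have := dist_triangle (g k) s m; have := dist_triangle z (g k) m.
have := dist_triangle m (g k) y; have := dg 0 k; have := dg k (dist z y).
have := dh1 0 i; have := dh1 i (dist z m).
by rewrite gz gy h1z h1m -s_i (dist_sym s (g k)) (dist_sym m (g k)); lia.
Qed.

Lemma hyperbolic_of_no_detour r0 : no_detour 20 r0 -> hyperbolic Γ.
Proof.
move=> nodet; apply/four_pointP; exists (6 * r0 + 6 * r0).
apply: four_point_of_medians => x y z g geo.
have [gx gy _] := geo; have dg := @dist_geodesic Γ x y g _ _ geo.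
have [i le_i min_g] : exists2 i, i <= dist x y &
    forall k, k <= dist x y -> dist z (g i) <= dist z (g k).
  pose F (i : 'I_(dist x y).+1) := dist z (g i).
  case: (@arg_minnP _ ord0 xpredT F isT) => i _ min_i; exists (i : nat).
    by rewrite -ltnS.
  by move=> k; rewrite -ltnS => lt_k; apply: (min_i (Ordinal lt_k)).
exists i => //.
have dx : dist (g i) x = i by rewrite -gx dg //; lia.
have dy : dist (g i) y = dist x y - i by rewrite -{1}gy dg //; lia.
(* [m = g i] cuts the side into two geodesics that leave [m], and [m] is a point
   nearest to [z] on each of them. *)
split.
  apply: (@no_detour_corner _ z _ _ (fun k => g (i - k)) nodet) => [|k _].
    by split=> [||j k]; rewrite ?dx ?subn0 ?subnn // => ?; rewrite dg; lia.
  by apply: min_g; lia.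
apply: (@no_detour_corner _ z _ _ (fun k => g (i + k)) nodet) => [|k].
  by split=> [||j k]; rewrite ?dy ?addn0 ?subnKC // => ?; rewrite dg; lia.
by rewrite dy => le_k; apply: min_g; lia.
Qed.

End FourPoint.
(** * The robber escapes along detours *)

Section Evasion.
Variables (Γ : graph) (v : Γ) (sigma psi rho R : nat) (safe : Γ -> Γ -> Prop).

(** [safe x c] relates robber and cop positions at the beginning of a stage.
    Following the robber's answers against a strategy produces one play, in which
    he always stands in the ball to be defended.  The answer is made legal even
    where [safe] fails, because the legality of the cop's moves, needed to keep
    [safe] going, is only known for plays in which the robber moves legally. *)
Lemma evasion (s : strategy Γ 1) :
  (forall c, exists x, safe x c) ->
  (forall x c, safe x c -> sigma + rho < dist c x /\ dist v x <= R) ->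
  (forall x c c', safe x c -> dist c c' <= sigma -> exists q,
     [/\ path_le psi x q, safe (last x q) c' &
         forall y, y \in x :: q -> rho < dist c' y]) ->
  ~ winning_strategy v sigma psi rho R s.
Proof.
move=> safe0 safe_far safe_step win.
have [x0 safe_x0] := safe0 (strat_start s ord0).
pose good x c' q :=
  safe (last x q) c' /\ forall y, y \in x :: q -> rho < dist c' y.
have answer (xc : Γ * Γ) : exists q, path_le psi xc.1 q /\
    ((exists2 c, safe xc.1 c & dist c xc.2 <= sigma) -> good xc.1 xc.2 q).
  have [[c sc le_c]|no_c] := pselect (exists2 c, safe xc.1 c & dist c xc.2 <= sigma).
    by have [q [xq sq farq]] := safe_step _ _ _ sc le_c; exists q.
  by exists [::].
have [flee fleeP] := choice answer.
pose turn (S : seq (seq Γ) * ('I_1 -> Γ) * Γ) : seq (seq Γ) * ('I_1 -> Γ) * Γ :=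
  let: (h, c, x) := S in
  let c' i := last (c i) (strat_move s x0 h i) in
  let q := flee (x, c' ord0) in (rcons h q, c', last x q).
pose state t := iter t turn ([::], strat_start s, x0).
pose moves t := flee ((state t).2,
  last ((state t).1.2 ord0) (strat_move s x0 (state t).1.1 ord0)).
pose P := Play (strat_start s) x0 (fun t => strat_move s x0 (state t).1.1) moves.
have histE t : (state t).1.1 = mkseq moves t.
  elim: t => // t IHt; rewrite mkseqS -IHt /moves /= -/(state t).
  by case: (state t) => [[h c] x].
have copE t i : cop_pos P t i = (state t).1.2 i.
  elim: t => // t IHt; rewrite /= -/(state t) IHt.
  by case: (state t) => [[h c] x].
have robE t : robber_pos P t = (state t).2.
  elim: t => // t IHt; rewrite /= -/(state t) IHt /moves.
  by case: (state t) => [[h c] x].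
have moveE t : moves t = flee (robber_pos P t, cop_pos P t.+1 ord0).
  by rewrite /= robE copE.
have [] := win P.
- by split=> // t; rewrite /= histE.
- by move=> t; rewrite [robber_move P t]moveE; case: (fleeP (robber_pos P t, cop_pos P t.+1 ord0)).
move=> legal wins.
have near_cop t : dist (cop_pos P t ord0) (cop_pos P t.+1 ord0) <= sigma.
  by have /andP[cq /(leq_trans (dist_last cq))] := legal t ord0.
have safe_t t : safe (robber_pos P t) (cop_pos P t ord0).
  elim: t => // t IHt.
  have [_ []] := fleeP (robber_pos P t, cop_pos P t.+1 ord0); last first.
    by rewrite -moveE.
  by exists (cop_pos P t ord0).
case: wins => [[t [i]]|[T far_T]]; last first.
  have := far_T T (leqnn T) _ (mem_head _ _).
  by rewrite (safe_far _ _ (safe_t T)).2.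
rewrite (ord1 i) => -[[x x_trace near_x]|[y y_trace near_y]]; last first.
  have [_ []] := fleeP (robber_pos P t, cop_pos P t.+1 ord0).
    by exists (cop_pos P t ord0); [exact: safe_t|exact: near_cop].
  by rewrite -moveE => _ /(_ y y_trace); rewrite ltnNge near_y.
have /andP[cq le_q] := legal t ord0.
have := leq_trans (mem_path_dist cq x_trace) le_q.
have := (safe_far _ _ (safe_t t)).1.
by have := dist_triangle (cop_pos P t ord0) x (robber_pos P t); lia.
Qed.

End Evasion.

Section DetourRobber.
Variables (Γ : graph) (M r k sigma psi : nat) (p a b : Γ).

(** The robber at [x] is running to [e], a plan that was made when the cop was at
    [c0] and that keeps him farther than [2 * k] from [c0].  The inequality bounds
    by [k] the total displacement of the cop until he arrives: in one stage the
    robber decreases the first summand by [sigma * psi] and the cop increases the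
    second one by at most that amount.  The goal is [p] if the cop was far from
    [p], otherwise an end of an arm.  When [n = 0] the robber is at rest. *)
Definition sheltered (x c : Γ) : Prop := exists c0 e n,
  [/\ linked (fun u => 2 * k < dist c0 u) n x e,
      sigma * n + psi * dist c0 c <= psi * k &
      e = p /\ 7 * k <= dist c0 p \/ (e = a \/ e = b) /\ dist c0 p <= 7 * k].

Lemma sheltered_far x c : 0 < psi -> sheltered x c -> k < dist c x.
Proof.
move=> psi_gt0 [c0 [e [n [/linked_l far_x le_n _]]]].
have : dist c0 c <= k.
  by rewrite -(leq_pmul2l psi_gt0); apply: leq_trans le_n; apply: leq_addl.
by have := dist_triangle c0 c x; lia.
Qed.

Lemma sheltered_bounded x c : detour M r p a b -> 0 < sigma ->
  sheltered x c -> dist p x <= psi * k + 2 * r.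
Proof.
move=> det sigma_gt0 [c0 [e [n [run le_n end_e]]]].
have [A [B [/dist_linked le_a /dist_linked le_b _ _]]] := det.
have := dist_linked run; have := dist_triangle p e x; rewrite (dist_sym e x).
have : dist p e <= 2 * r.
  by case: end_e => [[-> _]|[[->|->] _]] //; rewrite distxx.
by have := leq_pmull n sigma_gt0; have := leq_trans (leq_addr _ _) le_n; lia.
Qed.

(** Points of both arms near [c] would be at distance more than [2 * k] from [p],
    hence more than [4 * k] from each other. *)
Lemma one_side_clear (A B : Γ -> Prop) c :
  (forall u w, A u -> B w -> dist u w = dist p u + dist p w) ->
  sigma < k -> 6 * k <= dist c p + sigma ->
  (forall u, A u -> 2 * k < dist c u) \/ (forall u, B u -> 2 * k < dist c u).
Proof.
move=> AB lt_k far_c; have [|near_A] := pselect (forall u, A u -> 2 * k < dist c u).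
  by left.
right=> w Bw; rewrite ltnNge; apply/negP=> near_w; apply: near_A => u Au.
rewrite ltnNge; apply/negP=> near_u.
have := AB u w Au Bw; have := dist_triangle u c w.
have := dist_triangle c u p; have := dist_triangle c w p.
by rewrite (dist_sym u c) (dist_sym u p) (dist_sym w p); lia.
Qed.

Lemma bypass_clear c u :
  sigma < k -> 12 * k <= r -> dist c p <= 8 * k + sigma -> r <= dist p u -> 2 * k < dist c u.
Proof. by have := dist_triangle p c u; rewrite (dist_sym p c); lia. Qed.

Hypotheses (sigma_lt_k : sigma < k) (k_le_r : 12 * k <= r).
Hypotheses (psi_gt0 : 0 < psi) (psi_fast : sigma * ((M + 2) * r) <= psi * k).
Hypothesis det : detour M r p a b.

Lemma sheltered_run x c e n :
  linked (fun u => 2 * k < dist c u) n x e -> n <= (M + 2) * r ->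
  e = p /\ 7 * k <= dist c p \/ (e = a \/ e = b) /\ dist c p <= 7 * k ->
  sheltered x c.
Proof.
move=> run le_n end_e; exists c, e, n; split=> //.
rewrite distxx muln0 addn0; apply: leq_trans psi_fast.
by rewrite leq_mul2l le_n orbT.
Qed.

(** The robber has reached the goal [e] of his plan.  As the cop has moved by at
    most [k + sigma] since the plan was made, the threshold [7 * k] of that plan
    leaves the two cases below, and a new plan can be made from [e]. *)
Lemma sheltered_target e c :
  e = p /\ 6 * k <= dist c p + sigma \/
    (e = a \/ e = b) /\ dist c p <= 8 * k + sigma ->
  sheltered e c.
Proof using All.
have [A [B [Apa Bpb AB Dab]]] := det => end_e.
have clear_D le_c := sub_linked (fun u => @bypass_clear c u sigma_lt_k k_le_r le_c) (leqnn _) Dab.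
have far_c : 7 * k <= dist c p -> 6 * k <= dist c p + sigma by lia.
have [ge_c|lt_c] := leqP (7 * k) (dist c p).
  case: end_e => [[-> _]|[e_ab le_c]].
    by apply: (@sheltered_run _ _ p 0); [apply: linked_refl; lia| |left].
  have [A_clear|B_clear] := one_side_clear AB sigma_lt_k (far_c ge_c).
    have ap := linked_sym (sub_linked A_clear (leqnn _) Apa).
    have ba := linked_sym (clear_D le_c).
    case: e_ab => ->; [apply: sheltered_run ap _ _|apply: sheltered_run (linked_trans ba ap) _ _]; by [left|lia].
  have bp := linked_sym (sub_linked B_clear (leqnn _) Bpb).
  case: e_ab => ->; [apply: sheltered_run (linked_trans (clear_D le_c) bp) _ _|apply: sheltered_run bp _ _]; by [left|lia].
have le_c : dist c p <= 8 * k + sigma by lia.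
case: end_e => [[-> ge_c]|[e_ab _]].
  have [A_clear|B_clear] := one_side_clear AB sigma_lt_k ge_c.
    apply: sheltered_run (sub_linked A_clear (leqnn _) Apa) _ _; first by lia.
    by right; split; [left|lia].
  apply: sheltered_run (sub_linked B_clear (leqnn _) Bpb) _ _; first by lia.
  by right; split; [right|lia].
apply: (@sheltered_run _ _ e 0) => //; last by right; split=> //; lia.
apply: linked_refl; apply: bypass_clear => //.
by case: e_ab => ->; [exact: (linked_l Dab)|exact: (linked_r Dab)].
Qed.

Lemma sheltered_start c : exists x, sheltered x c.
Proof using All.
have [ge_c|lt_c] := leqP (6 * k) (dist c p + sigma).
  by exists p; apply: sheltered_target; left.
by exists a; apply: sheltered_target; right; split; [left|lia].
Qed.

Lemma sheltered_step x c c' : sheltered x c -> dist c c' <= sigma -> exists q,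
  [/\ path_le psi x q, sheltered (last x q) c' &
      forall y, y \in x :: q -> k < dist c' y + sigma].
Proof using All.
move=> [c0 [e [n [[q [xq qe le_q far_q]] le_n end_e]]]] le_c.
have le_c0 : dist c0 c <= k.
  by rewrite -(leq_pmul2l psi_gt0); apply: leq_trans le_n; apply: leq_addl.
have c0c' := dist_triangle c0 c c'.
have far_c' y : y \in x :: q -> k < dist c' y + sigma.
  by move/far_q; have := dist_triangle c0 c' y; lia.
have [le_psi|lt_psi] := leqP (size q) psi.
  exists q; rewrite /path_le xq le_psi; split=> //; rewrite qe.
  apply: sheltered_target; have := dist_triangle c0 c' p.
  have := dist_triangle c' c0 p; rewrite (dist_sym c' c0).
  by case: end_e => [[-> ?]|[e_ab ?]]; [left|right]; split=> //; lia.
have sub_q y : y \in x :: take psi q -> y \in x :: q.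
  by rewrite !inE => /predU1P[->|/mem_take->]; rewrite ?eqxx ?orbT.
exists (take psi q); move: (xq); rewrite -{1}(cat_take_drop psi q) cat_path.
case/andP=> xq1 xq2; rewrite /path_le xq1 size_takel ?(ltnW lt_psi) // leqnn.
split=> //; last by move=> y /sub_q; apply: far_c'.
exists c0, e, (n - psi); split=> //.
  exists (drop psi q); split=> //.
  - by rewrite -last_cat cat_take_drop.
  - by rewrite size_drop leq_sub2r.
  move=> u; rewrite inE => /predU1P[->|/mem_drop uq]; apply: far_q.
    by rewrite sub_q // mem_last.
  by rewrite inE uq orbT.
have le_psi_n : psi <= n by apply: leq_trans le_q; apply: ltnW.
apply: leq_trans le_n; rewrite mulnBr.
have : psi * dist c0 c' <= psi * dist c0 c + sigma * psi.
  by rewrite (mulnC sigma) -mulnDr leq_mul2l; apply/orP; right; lia.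
by have : sigma * psi <= sigma * n; [rewrite leq_mul2l le_psi_n orbT|lia].
Qed.

End DetourRobber.

(** The cop's reach [rho] is fixed before the detour is chosen, so the scale
    [k], about a twelfth of its radius, can be taken larger than [rho + sigma]. *)
Lemma no_detour_of_strong_cop_win (Γ : graph) M :
  strong_cop_win Γ 1 -> exists r0, no_detour Γ M r0.
Proof.
move=> win; apply: contrapT => no_r0.
have dets r0 : exists r p a b, r0 <= r /\ @detour Γ M r p a b.
  apply: contrapT => no_det; apply: no_r0; exists r0 => r p a b le_r d.
  by apply: no_det; exists r, p, a, b.
have [_ [v _]] := dets 0.
have [sigma sigma_gt0 win_psi] := win v.
(* [23 * k] is at least [r] for [k = r %/ 12 > 0], whatever the remainder. *)
have psi_gt0 : 0 < sigma * (M + 2) * 23 by rewrite !muln_gt0 sigma_gt0 addn2.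
have [rho rho_gt0 win_R] := win_psi _ psi_gt0.
have [r [p [a [b [le_r det]]]]] := dets (12 * (rho + sigma).+1).
set psi := sigma * (M + 2) * 23 in psi_gt0 win_psi win_R.
pose k := r %/ 12.
have le_k : (rho + sigma).+1 <= k by rewrite leq_divRL // mulnC.
have k_le_r : 12 * k <= r by rewrite mulnC leq_trunc_div.
have psi_fast : sigma * ((M + 2) * r) <= psi * k.
  by rewrite /psi -!mulnA !leq_mul2l; apply/orP; right; apply/orP; right; lia.
have sigma_lt_k : sigma < k by lia.
have [s win_s] := win_R (dist v p + (psi * k + 2 * r)).+1 isT.
apply: (evasion (safe := sheltered k sigma psi p a b) _ _ _ win_s).
- exact: sheltered_start sigma_lt_k k_le_r psi_gt0 psi_fast det.
- move=> x c sh; split; first by have := sheltered_far psi_gt0 sh; lia.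
  have := sheltered_bounded det sigma_gt0 sh.
  by have := dist_triangle v p x; lia.
- move=> x c c' sh le_c.
  have [q [xq shq far_q]] := sheltered_step sigma_lt_k k_le_r psi_gt0 psi_fast det sh le_c.
  by exists q; split=> // y /far_q; lia.
Qed.
(** * One cop wins on hyperbolic graphs *)

(** Here [c] lies on a geodesic from [o] to [y], and [c'] on one from [o] to [y'].
    The Gromov products of [c] with [y], of [y] with [y'] and of [y'] with [c'] at
    [o] are [k], at least [dist o y - P], and [k'], so two uses of the four-point
    inequality bound the product of [c] and [c'] from below. *)
Lemma geodesic_fellow_travel (Γ : graph) D (o y y' c c' : Γ) k k' P :
  four_point Γ D -> dist y y' <= P ->
  dist o c = k -> dist c y + k = dist o y ->
  dist o c' = k' -> dist c' y' + k' = dist o y' ->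
  k + P <= dist o y -> k' + P <= dist o y ->
  dist c' c <= (k - k') + (k' - k) + 2 * D.
Proof.
move=> fp le_y oc cy oc' cy' le_k le_k'.
have := fp c' y' y o; have := fp c' y c o.
rewrite (dist_sym y' y) (dist_sym y o) (dist_sym y' o) (dist_sym c o).
by rewrite (dist_sym c' o) (dist_sym y c); lia.
Qed.

Lemma lipschitz_of_adj (Γ Γ' : graph) (f : Γ -> Γ') K :
  (forall x y, adj x y -> dist (f x) (f y) <= K) ->
  forall x y, dist (f x) (f y) <= K * dist x y.
Proof.
move=> fK x y; have [p [xp <- <-]] := geodesic_path x y.
elim: p x xp => [|z p IHp] x /=; first by rewrite distxx.
move=> /andP[/fK xz /IHp zp]; have := dist_triangle (f x) (f z) (f (last z p)).
by rewrite mulnS; lia.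
Qed.

Section Chase.
Variables (Γ Γ' : graph) (f : Γ -> Γ') (g : Γ' -> Γ) (K D : nat).
Hypotheses (fK : forall x y, dist (f x) (f y) <= K * dist x y)
           (gK : forall x y, dist (g x) (g y) <= K * dist x y).
Hypotheses (fgK : cancel f g) (fp : four_point Γ' D).

(** The margin [P.+1] exceeds the length [P] of a robber move measured in [Γ'].
    Keeping it is the invariant of the chase; a robber who breaks it was already
    within reach before his move.  The cop steers by her real position and gives
    up moving if her target is out of range, so that she plays legally even after
    a capture. *)
Lemma strong_cop_win_of_four_point : strong_cop_win Γ 1.
Proof using All.
move=> v; pose o := f v; pose sigma := (K * (1 + 2 * D)).+1.
exists sigma => // psi psi_gt0.
pose P := K * psi; exists (K * (P.+1 + P)).+1 => // R R_gt0.
pose T := K * R; pose goal t := minn t T.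
have [geo geoP] := choice (geodesic_exists o).
have [route routeP] := choice (fun xy : Γ * Γ => geodesic_path xy.1 xy.2).
pose target x k := g (geo (f x) k).
pose chase c c' := if dist c c' <= sigma then route (c, c') else [::].
have chase_legal c c' : path_le sigma c (chase c c').
  rewrite /chase; case: ifP => // le_c; have [cp _ sp] := routeP (c, c').
  by rewrite /path_le cp sp.
have chase_last c c' : dist c c' <= sigma -> last c (chase c c') = c'.
  by rewrite /chase => ->; have [] := routeP (c, c').
pose reply (S : nat * Γ * Γ) :=
  let: (t, c, x) := S in chase c (target x (goal t.+1)).
pose update (S : nat * Γ * Γ) q :=
  let: (t, c, x) := S in (t.+1, last c (reply S), last x q).
pose s := @Strategy Γ 1 (fun _ => v)
  (fun x0 h _ => reply (foldl update (0, v, x0) h)).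
exists s => Q [startQ moveQ] legalQ.
pose cop t := cop_pos Q t ord0; pose rob t := robber_pos Q t.
have stateE t : foldl update (0, v, robber_start Q) (mkseq (robber_move Q) t)
    = (t, cop t, rob t).
  elim: t => [|t IHt]; first by rewrite /cop /= startQ.
  by rewrite mkseqS foldl_rcons IHt /cop /= moveQ /= IHt.
have chaseE t i : cop_move Q t i = chase (cop t) (target (rob t) (goal t.+1)).
  by rewrite moveQ /= stateE.
split=> [t i|]; first by rewrite (ord1 i) chaseE; apply: chase_legal.
have robP t y : y \in robber_trace Q t -> dist (f (rob t)) (f y) <= P.
  have /andP[rq le_q] := legalQ t.
  move/(mem_path_dist rq) => /leq_trans/(_ le_q) le_y.
  by apply: leq_trans (fK _ _) _; rewrite leq_mul2l le_y orbT.
have rob_step t : dist (f (rob t)) (f (rob t.+1)) <= P.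
  by apply: robP; apply: mem_last.
(* From here on the robber is assumed never to be captured. *)
have [|free] := pselect (captured (K * (P.+1 + P)).+1 Q); first by left.
right; have catch t c' n : cop t.+1 = g c' -> n <= P.+1 + P ->
    n < dist c' (f (rob t)).
  move=> cE le_n; rewrite ltnNge; apply/negP=> le_c; apply: free; exists t, ord0; right.
  exists (rob t); first exact: mem_head.
  rewrite -/(cop t.+1) cE -[rob t]fgK; apply: leq_trans (gK _ _) _.
  by rewrite leqW // leq_mul2l (leq_trans le_c le_n) orbT.
have geo_dist y k : k <= dist o y ->
    dist o (geo y k) = k /\ dist (geo y k) y + k = dist o y.
  move=> le_k; have [g0 g1 _] := geoP y; have dg := dist_geodesic (geoP y).
  have := dg 0 k; have := dg k (dist o y); rewrite g0 g1; lia.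
(* The cop aims at the position [y] that the robber left by his last move, as she
   moved before him; at the start any [y] will do. *)
have inv t : goal t + P.+1 <= dist o (f (rob t)) /\ exists y,
    [/\ dist (f (rob t)) y <= P, goal t <= dist o y & cop t = g (geo y (goal t))].
  elim: t => [|t [far_t [y [near_y le_y copE]]]].
    rewrite /goal min0n add0n; split; last first.
      exists (f (rob 0)); rewrite distxx; split=> //.
      by have [-> _ _] := geoP (f (rob 0)); rewrite fgK /cop /= startQ.
    rewrite leqNgt; apply/negP=> lt_o; apply: free; exists 0, ord0; left.
    exists v; first by rewrite /cop_trace /= startQ mem_head.
    rewrite -[v]fgK -[robber_pos Q 0]fgK; apply: leq_trans (gK _ _) _.
    by rewrite leqW // leq_mul2l; apply/orP; right; rewrite -/(rob 0) -/o; lia.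
  have goalS : goal t.+1 <= (goal t).+1 by rewrite /goal; lia.
  have goal_le : goal t <= goal t.+1 by rewrite /goal; lia.
  have le_goal : goal t.+1 <= dist o (f (rob t)) by lia.
  have [oc' cy'] := geo_dist _ _ le_goal; have [oc cy] := geo_dist _ _ le_y.
  have copS : cop t.+1 = g (geo (f (rob t)) (goal t.+1)).
    rewrite /cop /= -/(cop t) chaseE chase_last // copE.
    apply: leq_trans (gK _ _) _; rewrite leqW // leq_mul2l; apply/orP; right.
    have := geodesic_fellow_travel fp near_y oc' cy' oc cy.
    by lia.
  split; last first.
    exists (f (rob t)); split=> //.
    by rewrite dist_sym; apply: rob_step.
  rewrite leqNgt; apply/negP=> lt_o.
  have := dist_triangle o (f (rob t.+1)) (f (rob t)).
  rewrite (dist_sym (f (rob t.+1))).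
  have := rob_step t; have := catch t _ (dist o (f (rob t)) - goal t.+1) copS.
  by lia.
exists T => t le_T y /robP near_y; apply/negP=> le_R.
have [far_t _] := inv t; have := dist_triangle o (f y) (f (rob t)).
have : dist o (f y) <= T by apply: leq_trans (fK _ _) _; rewrite leq_mul2l le_R orbT.
by rewrite (dist_sym (f y)); move: far_t; rewrite /goal; lia.
Qed.

End Chase.

(** * Comparing Cayley graphs *)

Section CayleyMetric.
Variables (G : groupType) (S : seq G) (genS : generates S).
Local Open Scope group_scope.

Lemma cayley_dist_mull (x g h : cayley genS) :
  dist (x * g : cayley genS) (x * h : cayley genS) <= dist g h.
Proof.
rewrite -[leqRHS]mul1n; apply: lipschitz_of_adj g h => g h gh.
apply: (@dist_last _ (x * g : cayley genS) [:: x * h : cayley genS]).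
move: gh; rewrite /= andbT /cayley_adj (inj_eq (mulgI x)).
by rewrite !invgM -!mulgA !mulKg.
Qed.

Lemma cayley_lipschitz (S' : seq G) (genS' : generates S') : exists K,
  forall g h : G, @dist (cayley genS) g h <= K * @dist (cayley genS') g h.
Proof.
pose K := (\max_(s <- S') @dist (cayley genS) (1%g : G) s)%N.
have step (g h : G) : g^-1 * h \in S' -> @dist (cayley genS) g h <= K.
  move=> gh; have := @cayley_dist_mull g (1%g : G) (g^-1 * h).
  rewrite mulg1 mulVKg => /leq_trans; apply.
  by apply: (@leq_bigmax_seq _ S' xpredT (fun s : G => @dist (cayley genS) (1%g : G) s)).
exists K => g h.
apply: (@lipschitz_of_adj (cayley genS') (cayley genS) (fun x => x)) g h => g h.
by case/andP=> _ /orP[/step //|/step]; rewrite dist_sym.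
Qed.

End CayleyMetric.

Lemma sCop_eq1 (Γ : graph) : sCop Γ = Some 1 <-> strong_cop_win Γ 1.
Proof.
rewrite /sCop; split=> [|win]; last first.
  have win1 : strong_cop_number_of Γ 1 by apply/andP; split=> //; apply/asboolP.
  case: pselect => [exn|[]]; last by exists 1.
  case: ex_minnP => m /andP[m_gt0 _] /(_ 1 win1) le_m.
  by congr Some; apply/eqP; rewrite eqn_leq le_m.
case: pselect => // exn; case: ex_minnP => m /andP[_ /asboolP win] _ [].
by move=> m1; rewrite -m1.
Qed.

Theorem theorem1p1 (G : groupType) (S : seq G) (genS : generates S) :
  hyperbolic_group G <-> sCop (cayley genS) = Some 1.
Proof.
rewrite sCop_eq1; split=> [[S' [genS' /four_pointP[D fp]]]|win].
  have [K1 le1] := cayley_lipschitz genS genS'.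
  have [K2 le2] := cayley_lipschitz genS' genS.
  apply: (@strong_cop_win_of_four_point (cayley genS) (cayley genS')
            (fun x => x) (fun x => x) (maxn K1 K2) D) => // x y.
    by apply: leq_trans (le2 x y) _; rewrite leq_mul2r leq_maxr orbT.
  by apply: leq_trans (le1 x y) _; rewrite leq_mul2r leq_maxl orbT.
exists S, genS; have [r0 nodet] := no_detour_of_strong_cop_win 20 win.
exact: hyperbolic_of_no_detour nodet.
Qed.
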